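(* Let $S$ be a finite set and let $\leq_S$ be a partial order on $S$. Put $k=\lceil\log_2(|S|+1)\rceil$. Then there exist families $(\mathcal F_s)_{s\in S}$ and $(\mathcal G_s)_{s\in S}$ of sets of $k$-ary Boolean functions such that for all $s,t\in S$: (1) $\mathcal L(\mathcal F_s)\leq_{expr}\mathcal L(\mathcal F_t)$ if and only if $\mathcal L(\mathcal G_s)\leq_{poly}\mathcal L(\mathcal G_t)$ if and only if $s\leq_S t$; (2) all logics $\mathcal L(\mathcal G_s)$, $s\in S$, are equally expressive, and if $s\not\leq_S t$, then $\mathcal L(\mathcal G_s)$ is exponentially more succinct than $\mathcal L(\mathcal G_t)$.
   Context: Fix an infinite set $P$ of propositional variables. A Kripke model with $n$ modalities is $M=(W,R_1,\dots,R_n,\Pi)$ with $W\neq\emptyset$, $R_j\subseteq W\times W$, and $\Pi\colon P\to 2^W$; a pointed model is a pair $(M,w)$ with $w\in W$. A successor selection function $O$ (of arity $n$) assigns to each pointed model $(M,w)$ with $n$ modalities a set $O(M,w)\subseteq W$. For a set $\mathcal O$ of successor selection functions, the logic $\mathcal L(\mathcal O)$ has formulas $\varphi::=p\mid\neg\varphi\mid\varphi\vee\varphi\mid[O]\varphi$ ($p\in P$, $O\in\mathcal O$), with the usual semantics for $p,\neg,\vee$ and $M,w\models[O]\varphi$ iff $M,w'\models\varphi$ for all $w'\in O(M,w)$. The size $|\varphi|$ is the number of nodes of the syntax tree of $\varphi$. Two formulas are equivalent if they are satisfied by exactly the same pointed models. For an $n$-ary Boolean function $f\colon\{0,1\}^n\to\{0,1\}$,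 the successor selection function $O_f$ is defined by: $w'\in O_f(M,w)$ iff $f(r_1,\dots,r_n)=1$, where $r_j=1$ if $(w,w')\in R_j$ and $r_j=0$ otherwise. For a set $\mathcal F$ of $n$-ary Boolean functions, $\mathcal L(\mathcal F)$ denotes $\mathcal L(\{O_f: f\in\mathcal F\})$ (interpreted on Kripke models with $n$ modalities). For logics $\mathcal L_1=\mathcal L(\mathcal O_1)$, $\mathcal L_2=\mathcal L(\mathcal O_2)$: $\mathcal L_1\leq_{expr}\mathcal L_2$ if every $\mathcal L_1$-formula has an equivalent $\mathcal L_2$-formula; $\mathcal L_1\leq_{poly}\mathcal L_2$ if there is a fixed polynomial $q$ such that every $\mathcal L_1$-formula $\varphi$ has an equivalent $\mathcal L_2$-formula $\psi$ with $|\psi|\le q(|\varphi|)$. $\mathcal L_1,\mathcal L_2$ are equally expressive if $\mathcal L_1\leq_{expr}\mathcal L_2$ and $\mathcal L_2\leq_{expr}\mathcal L_1$. If they are equally expressive, $\mathcal L_1$ is exponentially more succinct than $\mathcal L_2$ if there is a sequence $(\varphi_i)_{i\in\mathbb N}$ of $\mathcal L_1$-formulas with $|\varphi_i|$ linear in $i$ and a constant $c>1$ such that for every $i$, every $\mathcal L_2$-formula equivalent to $\varphi_i$ has size at least $c^i$. *)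

(* Defs.v *)
From mathcomp Require Import all_boot all_order all_algebra.
From mathcomp Require Import boolp classical_sets functions cardinality reals.

Set Implicit Arguments.
Unset Strict Implicit.
Unset Printing Implicit Defensive.

Import Order.TTheory GRing.Theory Num.Theory.

Local Open Scope classical_set_scope.
Local Open Scope ring_scope.

Record model (P : Type) (n : nat) : Type := Model {
  world :> Type ;
  world_nonempty : inhabited world ;
  acc : 'I_n -> set (world * world) ;
  valuation : P -> set world }.

Definition ssf (P : Type) (n : nat) : Type := forall M : model P n, M -> set M.

Section Logic.
Variables (P : Type) (n : nat).

Inductive formula (Os : set (ssf P n)) : Type :=
| Var of P
| Neg of formula Os
| Or of formula Os & formula Os
| Box (o : ssf P n) of Os o & formula Os.

Fixpoint sat (Os : set (ssf P n)) (M : model P n) (w : M) (phi : formula Os)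
    : Prop :=
  match phi with
  | Var p => valuation p w
  | Neg psi => ~ sat w psi
  | Or psi chi => sat w psi \/ sat w chi
  | Box o _ psi => forall w' : M, o M w w' -> sat w' psi
  end.

Fixpoint fsize (Os : set (ssf P n)) (phi : formula Os) : nat :=
  match phi with
  | Var _ => 1%N
  | Neg psi => (fsize psi).+1
  | Or psi chi => (fsize psi + fsize chi).+1%N
  | Box _ _ psi => (fsize psi).+1
  end.

(* In the relations below, the logic L(Os) is represented by the set Os. *)
Definition equivalent (Os1 Os2 : set (ssf P n))
    (phi : formula Os1) (psi : formula Os2) : Prop :=
  forall (M : model P n) (w : M), sat w phi <-> sat w psi.

Definition expr_le (Os1 Os2 : set (ssf P n)) : Prop :=
  forall phi : formula Os1, exists psi : formula Os2, equivalent phi psi.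

Definition equally_expressive (Os1 Os2 : set (ssf P n)) : Prop :=
  expr_le Os1 Os2 /\ expr_le Os2 Os1.

Definition poly_le (R : realType) (Os1 Os2 : set (ssf P n)) : Prop :=
  exists q : {poly R}, forall phi : formula Os1,
    exists psi : formula Os2,
      equivalent phi psi /\ (fsize psi)%:R <= q.[(fsize phi)%:R].

Definition exp_more_succinct (R : realType) (Os1 Os2 : set (ssf P n)) : Prop :=
  equally_expressive Os1 Os2 /\
  exists (phi : nat -> formula Os1) (c : R),
    [/\ exists a b : nat, forall i, (fsize (phi i) <= a * i + b)%N,
        1 < c
      & forall (i : nat) (psi : formula Os2),
          equivalent (phi i) psi -> c ^+ i <= (fsize psi)%:R].

Definition boolfun : Type := {ffun n.-tuple bool -> bool}.

Definition ssf_of (f : boolfun) : ssf P n :=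
  fun M w => [set w' | f [tuple `[< acc j (w, w') >] | j < n] = true].

Definition ssfs_of (F : set boolfun) : set (ssf P n) := ssf_of @` F.

End Logic.

Arguments ssfs_of P {n} F _.

(* Main.v *)
Require Import Defs.
From mathcomp Require Import all_boot all_order all_algebra.
From mathcomp Require Import boolp classical_sets functions cardinality reals.
From mathcomp Require Import zify lra.

(** Each pair of worlds has a type, the vector of relations that hold between
    them.  There are at least [#|S| + 1] types; one of them, [N], is reserved
    as invisible to every modality.

    Expressivity: [F s] selects, for each [t <= s], the successors of one type
    [a t], with [a] injective.  If [s] is not below [t], then a loop of type
    [a s] is indistinguishable from a loop of type [N] in the logic of [F t].

    Succinctness: [G s] has all the single types other than [N], and for each
    [t <= s] a two-element set of types [A t], with [A] injective.  Boxes over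
    [A t] are conjunctions of two single-type boxes, so expressivity is the
    same.  With [A s = {a, b}], the formula [[A s]^i p] looks at the end of
    every path labelled by a word in [{a, b}^i].  If [s] is not below [t], then
    no modality of [G t] sees both [a] and [b], so each leaf of a formula over
    [G t] can look at the end of at most one such path, and a formula
    equivalent to [[A s]^i p] has at least [2 ^ i] leaves. *)

Set Implicit Arguments.
Unset Strict Implicit.
Unset Printing Implicit Defensive.

Local Open Scope classical_set_scope.

(** * Enlarging the set of modalities *)

Section LogicInclusion.
Variables (P : Type) (n : nat).
Implicit Types Os : set (ssf P n).

Lemma formula_widen Os1 Os2 : Os1 `<=` Os2 -> forall phi : formula Os1,
  exists psi : formula Os2, equivalent phi psi /\ fsize psi = fsize phi.
Proof.
move=> sub; elim=> [p|phi [psi [e sz]]|phi1 [psi1 [e1 sz1]] phi2 [psi2 [e2 sz2]]|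
                  o oO phi [psi [e sz]]].
- by exists (Var _ p).
- exists (Neg psi); split; last by rewrite /= sz.
  by move=> M w /=; rewrite (propext (e M w)).
- exists (Or psi1 psi2); split; last by rewrite /= sz1 sz2.
  by move=> M w /=; rewrite (propext (e1 M w)) (propext (e2 M w)).
- exists (Box (sub _ oO) psi); split; last by rewrite /= sz.
  by move=> M w /=; split=> H w' /H /e.
Qed.

Lemma expr_le_subset Os1 Os2 : Os1 `<=` Os2 -> expr_le Os1 Os2.
Proof. by move=> /formula_widen sub phi; have [psi []] := sub phi; exists psi. Qed.

Lemma poly_le_subset (R : realType) Os1 Os2 : Os1 `<=` Os2 -> poly_le R Os1 Os2.
Proof.
move=> /formula_widen sub; exists 'X%R => phi; have [psi [e sz]] := sub phi.
by exists psi; split=> //; rewrite hornerX sz.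
Qed.

End LogicInclusion.

(** * Exponential growth against polynomial bounds *)

Section PolynomialVersusExponential.
Variable R : realType.
Import Order.TTheory GRing.Theory Num.Theory.
Local Open Scope ring_scope.

Lemma horner_le_monomial (q : {poly R}) :
  exists C d : nat, forall x : R, 1 <= x -> q.[x] <= C%:R * x ^+ d.
Proof.
elim/poly_ind: q => [|q c [C [d H]]].
  by exists 0%N, 0%N => x _; rewrite horner0 mul0r.
exists (C + (Num.truncn `|c|).+1)%N, d.+1 => x x1.
rewrite hornerMXaddC natrD mulrDl; apply: lerD.
  by rewrite exprSr mulrA ler_wpM2r ?H// (le_trans ler01).
have cK : c <= (Num.truncn `|c|).+1%:R.
  by rewrite (le_trans (ler_norm c))// ltW// truncnS_gt.
by rewrite (le_trans cK)// ler_peMr ?ler0n// exprn_ege1.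
Qed.

Lemma monomial_lt_expn2 (C d : nat) : exists n : nat, (C * n.+1 ^ d < 2 ^ n)%N.
Proof.
(* Now [n.+1] is [4 ^ j] and [C <= 2 ^ C], so it suffices to compare exponents of 2, which works
   because [(j + 1) ^ 2 <= 4 ^ j]. *)
pose j := (C + d.*2).+1; exists (2 ^ (j * 2)).-1; rewrite prednK ?expn_gt0//.
have Cj : (C <= 2 ^ C)%N by rewrite ltnW// ltn_expl.
have jj : (j.+1 ^ 2 <= 2 ^ (j * 2))%N by rewrite expnM leq_exp2r// ltn_expl.
apply: (@leq_ltn_trans (2 ^ (C + j * 2 * d))); last first.
  by rewrite ltn_exp2l// -subn1 ltn_subRL (leq_trans _ jj)// /j -muln2; nia.
by rewrite expnD leq_mul// -expnM.
Qed.

Lemma monomial_lt_expr (c : R) (a b C d : nat) : 1 < c ->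
  exists i : nat, C%:R * (a * i + b)%:R ^+ d < c ^+ i.
Proof.
move=> c1.
have [r r2] : exists r : nat, 2 <= c ^+ r.
  (* As [r] exceeds [1 / (c - 1)], Bernoulli's inequality gives [c ^ r >= 1 + r (c - 1) >= 2]. *)
  pose r := (Num.truncn (c - 1)^-1).+1; exists r.
  have rc : 1 <= (c - 1) *+ r.
    rewrite -mulr_natr -ler_pdivrMl ?subr_gt0// mulr1.
    by rewrite ltW// truncnS_gt.
  have bern m : 1 + (c - 1) *+ m <= c ^+ m.
    elim: m => [|m IH]; first by rewrite mulr0n addr0.
    rewrite exprS; apply: (@le_trans _ _ (c * (1 + (c - 1) *+ m))); last first.
      by rewrite ler_pM2l// (lt_trans ltr01).
    have : 0 <= (c - 1) *+ m by rewrite mulrn_wge0// subr_ge0 ltW.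
    by rewrite mulrS; nra.
  by rewrite (le_trans _ (bern r))// -[2]/(1 + 1) lerD2l.
(* For [i = r * m], the constant absorbs the linear term: [a * i + b <= (a * r + b) * m.+1]. *)
have [m Hm] := monomial_lt_expn2 (C * (a * r + b) ^ d) d.
exists (r * m)%N; rewrite exprM.
apply: (@lt_le_trans _ _ (2 ^+ m)); last by rewrite lerXn2r ?nnegrE// (le_trans _ r2).
rewrite -!natrX -natrM ltr_nat; apply: leq_ltn_trans Hm.
rewrite -mulnA leq_mul2l -expnMn; apply/orP; right.
by case: (d) => // d'; rewrite leq_exp2r//; nia.
Qed.

Lemma exp_more_succinct_not_poly_le (P : Type) (n : nat) (Os1 Os2 : set (ssf P n)) :
  exp_more_succinct R Os1 Os2 -> ~ poly_le R Os1 Os2.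
Proof.
move=> [_ [phi [c [[a [b sz]] c1 low]]]] [q Hq].
have [C [d Cd]] := horner_le_monomial q.
have [i] := monomial_lt_expr a b C d c1.
have [psi [e szpsi]] := Hq (phi i).
apply/negP; rewrite -leNgt (le_trans (low i psi e))// (le_trans szpsi)//.
have size_gt0 : (0 < fsize (phi i))%N by case: (phi i).
apply: le_trans (Cd _ _) _; first by rewrite ler1n.
by rewrite ler_wpM2l ?ler0n// lerXn2r ?nnegrE ?ler0n// ler_nat.
Qed.

End PolynomialVersusExponential.

(** * Models with a prescribed type for each pair of worlds *)

Section TypedModels.
Variables (P : Type) (k : nat).
Local Notation type := (k.-tuple bool).

Definition typed_model (W : Type) (w0 : W) (ty : W -> W -> type)
    (V : P -> set W) : model P k :=
  Model (inhabits w0) (fun j => [set ww | tnth (ty ww.1 ww.2) j]) V.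

Lemma ssf_of_typed_model W w0 ty V (f : boolfun k) (w w' : W) :
  ssf_of f (M := typed_model w0 ty V) w w' = f (ty w w') :> Prop.
Proof.
rewrite /ssf_of /=; congr (is_true (f _)); apply: eq_from_tnth => j.
by rewrite tnth_mktuple /= asboolb.
Qed.

Definition loop_model (v : type) : model P k :=
  typed_model tt (fun _ _ => v) (fun _ => set0).

(** At a single looping world, a box is transparent if [f] selects the type of the loop and
    vacuously true otherwise. *)
Lemma sat_loop_model (F : set (boolfun k)) (v v' : type) :
  (forall f, F f -> f v = f v') -> forall phi : formula (ssfs_of P F),
  @sat _ _ _ (loop_model v) tt phi <-> @sat _ _ _ (loop_model v') tt phi.
Proof.
move=> Fvv'; elim=> [p|phi IH|phi1 IH1 phi2 IH2|o oF phi IH] //=.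
- by rewrite (propext IH).
- by rewrite (propext IH1) (propext IH2).
- have [f Ff fo] := oF; subst o; split=> H []; move: (H tt); rewrite !ssf_of_typed_model Fvv'//.
    by move=> {}H /H /IH.
  by move=> {}H /H /IH.
Qed.

(** * Counting the words whose end a formula can observe *)

Section Words.
Variables (N a b : type).

Definition edge (x : bool) : type := if x then a else b.

(* Worlds are words: a nonempty word has an edge to its tail, whose type is
   given by its first letter, and the variables can hold at [[::]] only.  Thus
   the world [u] is the start of the path labelled by [u]. *)
Definition word_edge (u v : seq bool) : type :=
  if u is x :: u' then if u' == v then edge x else N else N.

Definition word_model (V : Prop) : model P k :=
  typed_model [::] word_edge (fun _ => [set u | u = [::] /\ V]).

Variable F : set (boolfun k).
Implicit Types psi : formula (ssfs_of P F).

(** The two models differ only in the valuation at [[::]], so this says that [psi] at [u] looks at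
    the end of the path. *)
Definition seen (u : seq bool) psi : Prop :=
  ~ (@sat _ _ _ (word_model True) u psi <-> @sat _ _ _ (word_model False) u psi).

Definition seen_words (n : nat) psi : {set n.-tuple bool} :=
  [set u : n.-tuple bool | `[< seen u psi >]].

Lemma sat_box_word V x (u : seq bool) (f : boolfun k) (Ff : ssfs_of P F (ssf_of f)) psi :
  ~~ f N ->
  @sat _ _ _ (word_model V) (x :: u) (Box Ff psi) <->
  (f (edge x) -> @sat _ _ _ (word_model V) u psi).
Proof.
move=> fN /=; split=> [H fx|H v].
  by apply: H; rewrite ssf_of_typed_model /= eqxx.
rewrite ssf_of_typed_model /=; case: eqP => [<- //|_ fN'].
by rewrite fN' in fN.
Qed.

Lemma seen_wordsP n (u : n.-tuple bool) psi :
  reflect (seen u psi) (u \in seen_words n psi).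
Proof. by rewrite inE; apply: asboolP. Qed.

Hypothesis FN : forall f, F f -> ~~ f N.
Hypothesis Fab : forall f, F f -> ~~ (f a && f b).

(** A variable sees at most the empty word, and a disjunction only what a disjunct sees. A box
    follows at most one letter [x], so it sees only words [x :: u] with [u] seen by its body; hence
    [n] varies in the induction. *)
Lemma card_seen_words psi n : #|seen_words n psi| <= fsize psi.
Proof.
elim: psi n => [p|psi IH|psi1 IH1 psi2 IH2|o oF psi IH] n.
- case: n => [|n].
    by rewrite (leq_trans (max_card _))// card_tuple expn0.
  rewrite (_ : seen_words _ _ = finset.set0) ?cards0//.
  apply/finset.setP => u; rewrite finset.in_set0; apply/seen_wordsP; apply.
  by case/tupleP: u => x u; split=> -[].
- apply: leqW; apply: leq_trans (IH n).
  apply/subset_leq_card/fintype.subsetP => u /seen_wordsP H.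
  by apply/seen_wordsP => e; apply: H; rewrite /= (propext e).
- apply: leqW; apply: leq_trans (leq_add (IH1 n) (IH2 n)).
  apply: leq_trans (leq_card_setU _ _).
  apply/subset_leq_card/fintype.subsetP => u /seen_wordsP H; rewrite finset.in_setU.
  have [//|/seen_wordsP/contrapT e1] := boolP (u \in seen_words n psi1).
  by apply/seen_wordsP => e2; apply: H; rewrite /= (propext e1) (propext e2).
- have [f Ff fo] := oF; subst o.
  apply: leqW; case: n => [|n].
    rewrite (_ : seen_words _ _ = finset.set0) ?cards0//.
    apply/finset.setP => u; rewrite finset.in_set0; apply/seen_wordsP; apply.
    rewrite (tuple0 u).
    by split=> _ v; rewrite ssf_of_typed_model /= (negbTE (FN Ff)).
  (* By [Fab], [f] cannot select both edge types; if it selects neither, [false] is a default. *)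
  have [x fx] : exists x, forall y, f (edge y) -> y = x.
    have := Fab Ff; case fa: (f a) => /= fb; [exists true|exists false].
      by case=> //= fb'; rewrite fb' in fb.
    by case=> //=; rewrite fa.
  apply: leq_trans (IH n); apply: leq_trans (leq_imset_card (cons_tuple x) _).
  apply/subset_leq_card/fintype.subsetP => u; case/tupleP: u => y u /seen_wordsP.
  rewrite /seen !sat_box_word ?FN// => H.
  case fy: (f (edge y)) H => H; last by exfalso; apply: H.
  rewrite (fx _ fy); apply/imsetP; exists u; last exact: val_inj.
  by apply/seen_wordsP => e; apply: H; rewrite (propext e).
Qed.

Lemma sat_box_iter V (f : boolfun k) (Ff : ssfs_of P F (ssf_of f)) p u :
  ~~ f N -> f a -> f b ->
  @sat _ _ _ (word_model V) u (iter (size u) (Box Ff) (Var _ p)) <-> V.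
Proof.
move=> fN fa fb; elim: u => [|x u IH]; first by split=> [[]|].
rewrite [iter _ _ _]/= sat_box_word//; apply: iff_trans IH; split=> [|//].
by apply; case: x.
Qed.

End Words.

(** The iterated box sees all [2 ^ n] words of length [n], and equivalent formulas see the same
    words. *)
Lemma equivalent_box_iter_size N a b (F1 F2 : set (boolfun k)) (f : boolfun k)
    (Ff : ssfs_of P F1 (ssf_of f)) (p : P) (n : nat) (psi : formula (ssfs_of P F2)) :
  ~~ f N -> f a -> f b ->
  (forall g, F2 g -> ~~ g N) -> (forall g, F2 g -> ~~ (g a && g b)) ->
  equivalent (iter n (Box Ff) (Var _ p)) psi -> 2 ^ n <= fsize psi.
Proof.
move=> fN fa fb F2N F2ab e.
rewrite -card_bool -card_tuple -cardsT.
apply: leq_trans (card_seen_words F2N F2ab psi n).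
apply/subset_leq_card/fintype.subsetP => u _; apply/seen_wordsP.
have iterE V : @sat _ _ _ (word_model N a b V) u (iter n (Box Ff) (Var _ p)) <-> V.
  by rewrite -{2}(size_tuple u); apply: sat_box_iter.
by move=> H; apply/(iterE False)/e/H/e/iterE.
Qed.

End TypedModels.

(** * Modalities given by sets of types *)

Section SetModalities.
Variables (P : Type) (k : nat).
Local Notation type := (k.-tuple bool).
Local Notation tset := {set k.-tuple bool}.

Definition indic (A : tset) : boolfun k := [ffun v => v \in A].

Definition set_logic (As : set tset) : set (ssf P k) := ssfs_of P (indic @` As).

Lemma set_logicS As Bs : As `<=` Bs -> set_logic As `<=` set_logic Bs.
Proof. by move=> sub; do 2!apply: image_subset. Qed.

Lemma set_logic_mem As A : As A -> set_logic As (ssf_of (indic A)).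
Proof. by move=> AA; exists (indic A) => //; exists A. Qed.

(** No variable holds in a loop model, so [[A] p] fails at the loop of type [v] but holds vacuously
    at the loop of type [N]. *)
Lemma set_logic_not_expr_le (As Bs : set tset) A v N (p : P) :
  As A -> v \in A -> N \notin A ->
  (forall B, Bs B -> (v \in B) = (N \in B)) ->
  ~ expr_le (set_logic As) (set_logic Bs).
Proof.
move=> AA vA NA BsvN /(_ (Box (set_logic_mem AA) (Var _ p))) [psi e].
have /= nv := e (loop_model P v) tt; have /= nN := e (loop_model P N) tt.
have /nv : @sat _ _ _ (loop_model P v) tt psi.
  apply/(@sat_loop_model _ _ _ v N) => [_ [B /BsvN vN <-]|]; first by rewrite !ffunE.
  by apply/nN => w'; rewrite ssf_of_typed_model ffunE (negbTE NA).
by move=> /(_ tt); rewrite ssf_of_typed_model ffunE; apply.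
Qed.

(* [[{x, y}] phi] is [[x] phi /\ [y] phi]. *)
Lemma pair_expr_le (As Bs : set tset) :
  (forall A, As A -> exists x y,
    [/\ A = [set x; y]%SET, Bs [set x]%SET & Bs [set y]%SET]) ->
  expr_le (set_logic As) (set_logic Bs).
Proof.
move=> AsBs; elim=> [p|phi [psi e]|phi1 [psi1 e1] phi2 [psi2 e2]|o oA phi [psi e]].
- by exists (Var _ p).
- by exists (Neg psi) => M w /=; rewrite (propext (e M w)).
- by exists (Or psi1 psi2) => M w /=; rewrite (propext (e1 M w)) (propext (e2 M w)).
- have [_ [A AA <-] oE] := oA; subst o.
  have [x [y [AE Bx By]]] := AsBs A AA; subst A.
  exists (Neg (Or (Neg (Box (set_logic_mem Bx) psi))
                  (Neg (Box (set_logic_mem By) psi)))) => M w /=.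
  rewrite not_orE !notK; split=> [H|[Hx Hy] w'].
    split=> w' ; rewrite /ssf_of /= ffunE inE => ty;
      by apply/e/H; rewrite /ssf_of /= ffunE !inE ty ?orbT.
  rewrite /ssf_of /= ffunE !inE => /orP[] ty; apply/e; [apply: Hx|apply: Hy];
    by rewrite /ssf_of /= ffunE inE.
Qed.

Lemma pair_exp_more_succinct (R : realType) (p : P) (As Bs : set tset) N a b :
  equally_expressive (set_logic As) (set_logic Bs) ->
  As [set a; b]%SET -> N != a -> N != b ->
  (forall B, Bs B -> N \notin B) ->
  (forall B, Bs B -> ~~ ((a \in B) && (b \in B))) ->
  exp_more_succinct R (set_logic As) (set_logic Bs).
Proof.
move=> eqe Aab Na Nb BN Bab; split=> //.
exists (fun i => iter i (Box (set_logic_mem Aab)) (Var _ p)), 2%:R%R; split.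
- by exists 1, 1; elim=> //= i; rewrite !mul1n addSn ltnS.
- by rewrite Num.Theory.ltr1n.
- move=> i psi e; rewrite -GRing.natrX Num.Theory.ler_nat.
  apply: (@equivalent_box_iter_size _ _ N a b) e; rewrite ?ffunE ?inE ?eqxx ?orbT//.
  + by rewrite negb_or Na Nb.
  + by move=> _ [B /BN ? <-]; rewrite ffunE.
  + by move=> _ [B /Bab ? <-]; rewrite !ffunE.
Qed.

End SetModalities.

Arguments set_logic P {k} As _.

Lemma injection_into (S T : finType) (A : {set T}) : #|S| <= #|A| ->
  exists2 f : S -> T, injective f & forall s, f s \in A.
Proof.
move=> SA; exists (fun s => enum_val (widen_ord SA (enum_rank s))).
  by move=> s t /enum_val_inj /(congr1 val) /= /val_inj /enum_rank_inj.
by move=> s; apply: enum_valP.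
Qed.

Theorem theorem1 (R : realType) (P : Type) (P_infinite : infinite_set [set: P])
    (disp : Order.disp_t) (S : finPOrderType disp) :
  let k := up_log 2 (#|S| + 1) in
  exists F G : S -> set (boolfun k),
    forall s t : S,
      [/\ expr_le (ssfs_of P (F s)) (ssfs_of P (F t)) <->
            poly_le R (ssfs_of P (G s)) (ssfs_of P (G t)),
          poly_le R (ssfs_of P (G s)) (ssfs_of P (G t)) <-> (s <= t)%O,
          equally_expressive (ssfs_of P (G s)) (ssfs_of P (G t))
        & ~ (s <= t)%O ->
            exp_more_succinct R (ssfs_of P (G s)) (ssfs_of P (G t))].
Proof.
move=> k; have [p _] := infinite_setN0 P_infinite.
have [S1|S2] := leqP #|S| 1.
  (* A one-element [S] has [k = 1], which leaves one type besides [N] and hence no pair, so this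
     case is treated apart. *)
  exists (fun=> set0), (fun=> set0) => s t.
  have -> : s = t by apply: (fintype_le1P S1).
  have sub : ssfs_of P (@set0 (boolfun k)) `<=` ssfs_of P set0 by [].
  have ple := poly_le_subset R sub; have ele := expr_le_subset sub.
  by split=> //; rewrite Order.POrderTheory.lexx.
have ltSk : #|S| < 2 ^ k by rewrite -addn1 up_logP.
pose N : k.-tuple bool := [tuple of nseq k false].
pose T := [set~ N]%SET.
have cardT : #|T| = (2 ^ k).-1 by rewrite cardsC1 card_tuple card_bool.
have leST : #|S| <= #|T| by rewrite cardT; lia.
(* A set of [m >= 3] types has [m (m - 1) / 2 >= m] pairs, enough for an injective [A]. *)
have T3 : 2 < #|T|.
  have : 1 < k.
    rewrite ltnNge; apply/negP => k1.
    by have := leq_pexp2l (ltn0Sn 1) k1; lia.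
  by rewrite cardT => /(leq_pexp2l (ltn0Sn 1)); lia.
have leSpairs : #|S| <= #|[set A : {set k.-tuple bool} | A \subset T & #|A| == 2]%SET|.
  rewrite cards_draws (leq_trans leST)// bin2 -divn2 leq_divRL// leq_mul2l.
  by rewrite -ltnS prednK ?T3 ?orbT// (ltnW (ltnW T3)).
have [a a_inj aT] := injection_into leST.
have [A A_inj Apairs] := injection_into leSpairs.
have neqN v : v \in T -> N != v by rewrite !inE eq_sym.
have AT s : A s \subset T by have := Apairs s; rewrite inE => /andP[].
have A2 s : #|A s| = 2 by have := Apairs s; rewrite inE => /andP[_ /eqP].
have NT (B : {set k.-tuple bool}) : B \subset T -> N \notin B.
  by move=> /fintype.subsetP BT; apply/negP => /BT; rewrite !inE eqxx.
pose Fs (s : S) := [set B : {set k.-tuple bool} | exists2 t, (t <= s)%O & B = [set a t]%SET].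
pose Gs (s : S) := [set B : {set k.-tuple bool} | B \subset T /\ (#|B| = 1 \/ exists2 t, (t <= s)%O & B = A t)].
have Fmono s t : (s <= t)%O -> Fs s `<=` Fs t.
  by move=> st B [u us ->]; exists u => //; apply: Order.POrderTheory.le_trans st.
have Gmono s t : (s <= t)%O -> Gs s `<=` Gs t.
  move=> st B [BT [|[u us ->]]]; split=> //; [by left|right].
  by exists u => //; apply: Order.POrderTheory.le_trans st.
exists (fun s => @indic k @` Fs s), (fun s => @indic k @` Gs s) => s t.
have Gle u v : expr_le (set_logic P (Gs u)) (set_logic P (Gs v)).
  apply: pair_expr_le => B [BT BG].
  have [x [y BE]] : exists x y, B = [set x; y]%SET.
    case: BG => [/eqP/cards1P[x ->]|[w _ BA]].
      by exists x, x; rewrite finset.setUid.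
    by have /eqP/cards2P[x [y [_ Axy]]] := A2 w; exists x, y; rewrite BA.
  have Gsingle z : z \in B -> Gs v [set z]%SET.
    by move=> zB; split; [rewrite finset.sub1set (fintype.subsetP BT)|left;
      rewrite cards1].
  by exists x, y; split=> //; apply: Gsingle; rewrite BE !inE eqxx ?orbT.
have Geq : equally_expressive (set_logic P (Gs s)) (set_logic P (Gs t)) by [].
have Gsucc : ~ (s <= t)%O ->
    exp_more_succinct R (set_logic P (Gs s)) (set_logic P (Gs t)).
  move=> nst; have /eqP/cards2P[x [y [xy Axy]]] := A2 s.
  apply: (@pair_exp_more_succinct _ _ _ p _ _ N x y) => //.
  - by rewrite -Axy; split; [|right; exists s].
  - by apply/neqN/(fintype.subsetP (AT s)); rewrite Axy !inE eqxx.
  - by apply/neqN/(fintype.subsetP (AT s)); rewrite Axy !inE eqxx orbT.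
  - by move=> B [/NT].
  - move=> B [_ Bt]; apply/negP => /andP[xB yB].
    (* A singleton is too small to contain [A s], and containment in [A u] forces [A s = A u],
       whence [s = u <= t]. *)
    have AsB : A s \subset B by rewrite Axy finset.subUset !finset.sub1set xB.
    case: Bt => [B1|[u ut BA]]; first by have := subset_leq_card AsB; rewrite A2 B1.
    apply: nst; suff -> : s = u by [].
    by apply: A_inj; apply/eqP; rewrite eqEcard !A2 leqnn andbT -BA.
have Gpoly : poly_le R (set_logic P (Gs s)) (set_logic P (Gs t)) <-> (s <= t)%O.
  split=> [ple|st]; last by apply/poly_le_subset/set_logicS/Gmono.
  by apply: contrapT => /Gsucc /exp_more_succinct_not_poly_le.
have Fexpr : expr_le (set_logic P (Fs s)) (set_logic P (Fs t)) <-> (s <= t)%O.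
  split=> [|st]; last by apply/expr_le_subset/set_logicS/Fmono.
  apply: contraPP => nst.
  apply: (@set_logic_not_expr_le _ _ _ _ [set a s]%SET (a s) N p).
  - by exists s.
  - by rewrite inE.
  - by rewrite inE neqN.
  - move=> _ [u ut ->]; rewrite !inE (negbTE (neqN _ (aT u))).
    by apply/negP => /eqP /a_inj su; apply: nst; rewrite su.
by split=> //; apply: iff_trans Fexpr (iff_sym Gpoly).
Qed.
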